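(* Let $m\geq 4$ and let $g\in L^\infty_m(\mathbb{S}^1)$ be a solution of the steady problem \[ G\,\partial_\theta g=0,\qquad 4G+\partial_{\theta\theta}G=g . \] Then either $g$ is constant, or $g$ is piecewise constant with a finite number of jumps, and these jumps occur at the global maxima and minima of $\partial_\theta G$, which have exactly opposite non-zero values.
   Context: $\mathbb{S}^1=\mathbb{R}/2\pi\mathbb{Z}$. $L^\infty_m(\mathbb{S}^1)$ denotes bounded measurable $m$-fold symmetric functions, i.e. $g(\theta+2\pi/m)=g(\theta)$. For $m\ge 3$ the operator $4+\partial_{\theta\theta}$ is invertible on $m$-fold symmetric functions, so $G=(4+\partial_{\theta\theta})^{-1}g\in W^{2,\infty}$ is determined by $g$; the equation $G\partial_\theta g=0$ is understood in the sense of distributions, e.g. as $\partial_\theta(Gg)-(\partial_\theta G)g=0$. *)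

(* Defs.v *)
From mathcomp Require Import all_boot all_order all_algebra.
From mathcomp Require Import all_classical all_reals all_analysis.
Import Order.TTheory GRing.Theory Num.Theory.
Set Implicit Arguments. Unset Strict Implicit. Unset Printing Implicit Defensive.
Local Open Scope ring_scope.
Local Open Scope classical_set_scope.

Section defs.
Context {R : realType}.
Local Notation mu := (@lebesgue_measure R).

(* m-fold symmetry on S^1 = R/2piZ, functions represented as functions on R *)
Definition m_symmetric (m : nat) (f : R -> R) : Prop :=
  forall x, f (x + 2 * pi / m%:R) = f x.

Definition smooth (phi : R -> R) : Prop :=
  exists d : nat -> R -> R, d 0%N = phi /\
    forall (n : nat) (x : R), is_derive x 1 (d n) (d n.+1 x).

Definition test_fun (phi : R -> R) : Prop :=
  smooth phi /\ forall x, phi (x + 2 * pi) = phi x.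

(* G in W^{2,oo} solves 4G + G'' = g: G is C^1 and G' is the primitive of g - 4G *)
Definition solves_resolvent (g G : R -> R) : Prop :=
  (forall x, derivable G x 1) /\
  forall x y, x <= y ->
    (derive1 G y - derive1 G x)%:E = (\int[mu]_(t in `[x, y]%classic) (g t - 4 * G t)%:E)%E.

(* G d_theta g = 0 in distributions on S^1, i.e. d(Gg) - G' g = 0:
   for every test function phi, - int G g phi' - int G' g phi = 0 *)
Definition steady_eq (g G : R -> R) : Prop :=
  forall phi, test_fun phi ->
    (\int[mu]_(t in `[0%R, (2 * pi)%R]%classic) (G t * g t * derive1 phi t + derive1 G t * g t * phi t)%:E)%E
    = 0%E.

Definition arc_end (J : seq R) (i : nat) : R :=
  if (i.+1 < size J)%N then nth 0 J i.+1 else nth 0 J 0 + 2 * pi.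

Definition pw_const_jumps (g : R -> R) (J : seq R) : Prop :=
  (0 < size J)%N /\ sorted <%R J /\ all (fun x => (0 <= x) && (x < 2 * pi)) J /\
  exists c : nat -> R, forall i, (i < size J)%N ->
    {ae mu, forall x, nth 0 J i < x < arc_end J i -> g x = c i} /\
    c i != c ((i + size J).-1 %% size J)%N.

Definition at_opposite_extrema (f : R -> R) (J : seq R) : Prop :=
  exists M : R, M != 0 /\ (forall x, - M <= f x <= M) /\
    (exists x, f x = M) /\ (exists x, f x = - M) /\
    all (fun t => (f t == M) || (f t == - M)) J.

End defs.

(* Main.v *)
(* With [F = G'], the function [2 G^2 + F^2 / 2] is a primitive of [F g], so the weak
   form of [(G g)' = F g] gives a first integral [G g - 2 G^2 - F^2 / 2 = C] a.e.,
   equivalently [(G F)' = 3/2 F^2 - 2 G^2 + C] everywhere.  Where [G] vanishes this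
   reads [F^2 = - 2 C]; where it does not, [F] is differentiable and [g = 4 G + F']
   is locally constant.  Hence between two consecutive zeros [a < b] of [G] one has
   [G'' + 4 G = c], which is solved explicitly: [F b = - F a], [c] and [F a] have
   opposite signs as soon as [b - a < pi / 2], and [|F| <= |F a|] on the arc.  The
   length [b - a] is at most the period [2 pi / m <= pi / 2], and it differs from the
   period because [F b = - F a].  So the zeros of [G] are the jumps of [g], and [|F|]
   takes its maximum there. *)
Require Import Defs.
From mathcomp Require Import all_boot all_order all_algebra.
From mathcomp Require Import all_classical all_reals all_analysis.
From mathcomp Require Import measurable_realfun.
From mathcomp Require Import ring lra.
Import Order.TTheory GRing.Theory Num.Theory.
Import numFieldNormedType.Exports.
Set Implicit Arguments. Unset Strict Implicit. Unset Printing Implicit Defensive.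
Local Open Scope ring_scope.
Local Open Scope classical_set_scope.

(** * Integrals of bounded measurable functions *)

Section BoundedMeasurable.
Context {R : realType}.
Local Notation mu := (@lebesgue_measure R).
Implicit Types (f h F H : R -> R) (a b x y : R).

(** A bound valid at every point keeps null sets out of the estimates. An essentially bounded [g] is
    brought into this class at the end, by truncation. *)
Definition bounded_mfun f : Prop :=
  measurable_fun [set: R] f /\ exists K : R, forall x, `|f x| <= K.

Lemma bounded_mfun_cst (k : R) : bounded_mfun (fun=> k).
Proof. by split; [exact: measurable_cst|exists `|k|]. Qed.

Lemma bounded_mfunD f h :
  bounded_mfun f -> bounded_mfun h -> bounded_mfun (fun x => f x + h x).
Proof.
move=> [mf [K fK]] [mh [L hL]]; split; first exact: measurable_funD.
by exists (K + L) => x; rewrite (le_trans (ler_normD _ _))// lerD.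
Qed.

Lemma bounded_mfunM f h :
  bounded_mfun f -> bounded_mfun h -> bounded_mfun (fun x => f x * h x).
Proof.
move=> [mf [K fK]] [mh [L hL]]; split; first exact: measurable_funM.
by exists (K * L) => x; rewrite normrM ler_pM.
Qed.

Lemma bounded_mfunZ (k : R) f : bounded_mfun f -> bounded_mfun (fun x => k * f x).
Proof. by move=> bf; exact: bounded_mfunM (bounded_mfun_cst k) bf. Qed.

Lemma bounded_mfunB f h :
  bounded_mfun f -> bounded_mfun h -> bounded_mfun (fun x => f x - h x).
Proof.
move=> bf /(bounded_mfunZ (-1)) bh.
by have := bounded_mfunD bf bh; under eq_fun do rewrite mulN1r.
Qed.

Lemma bounded_mfun_gt0 f : bounded_mfun f -> exists2 K : R, 0 < K & forall x, `|f x| <= K.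
Proof.
move=> [_ [K fK]]; exists (K + 1); first by rewrite ltr_wpDl// (le_trans _ (fK 0)).
by move=> x; rewrite (le_trans (fK x))// lerDl.
Qed.

Lemma bounded_mfun_integrable f a b :
  bounded_mfun f -> mu.-integrable `[a, b] (EFin \o f).
Proof.
move=> [mf [K fK]]; apply: measurable_bounded_integrable => //.
- by rewrite /= lebesgue_measure_itv/=; case: ifP => // _; rewrite -EFinB ltry.
- exact: measurable_funTS.
- exists K; split; first exact: num_real.
  by move=> L KL x _ /=; rewrite (le_trans (fK x))// ltW.
Qed.

Definition intcc f a b := (\int[mu]_(t in `[a, b]) f t)%R.

Lemma intcc_EFin f a b : bounded_mfun f ->
  (\int[mu]_(t in `[a, b]) (f t)%:E)%E = (intcc f a b)%:E.
Proof.
move=> bf; rewrite /intcc /Rintegral fineK//.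
exact: integrable_fin_num (bounded_mfun_integrable _ _ bf).
Qed.

Lemma intccD f h a b : bounded_mfun f -> bounded_mfun h ->
  intcc (fun x => f x + h x) a b = intcc f a b + intcc h a b.
Proof. by move=> bf bh; rewrite /intcc RintegralD//; exact: bounded_mfun_integrable. Qed.

Lemma intccB f h a b : bounded_mfun f -> bounded_mfun h ->
  intcc (fun x => f x - h x) a b = intcc f a b - intcc h a b.
Proof. by move=> bf bh; rewrite /intcc RintegralB//; exact: bounded_mfun_integrable. Qed.

Lemma intccZ (k : R) f a b : bounded_mfun f ->
  intcc (fun x => k * f x) a b = k * intcc f a b.
Proof. by move=> bf; rewrite /intcc RintegralZl//; exact: bounded_mfun_integrable. Qed.

Lemma intcc_cst (k : R) a b : a <= b -> intcc (fun=> k) a b = k * (b - a).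
Proof.
move=> ab; rewrite /intcc Rintegral_cst//= lebesgue_measure_itv/= lte_fin.
by move: ab; rewrite le_eqVlt => /predU1P[->|->//]; rewrite ltxx subrr.
Qed.

Lemma intcc_bound f a b (K : R) : bounded_mfun f -> a <= b ->
  (forall x, a <= x <= b -> `|f x| <= K) -> `|intcc f a b| <= K * (b - a).
Proof.
move=> bf ab fK; rewrite -intcc_cst//.
apply: le_trans (le_normr_Rintegral _ _) _ => //; first exact: bounded_mfun_integrable.
apply: le_Rintegral => //.
- apply: (@bounded_mfun_integrable (fun x => `|f x|)); case: bf => mf [L fL]; split.
    exact: measurableT_comp.
  by exists L => x; rewrite normr_id.
- exact: bounded_mfun_integrable (bounded_mfun_cst _).
Qed.

Lemma intcc_chasles f a b c : bounded_mfun f -> a <= b -> b <= c ->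
  intcc f a c = intcc f a b + intcc f b c.
Proof.
move=> bf ab bc; rewrite /intcc.
have := @Rintegral_itvB _ f (BLeft a) (BRight c) b.
move=> /(_ (bounded_mfun_integrable _ _ bf)); rewrite !bnd_simp => /(_ ab bc).
rewrite Rintegral_itv_obnd_cbnd; last first.
  apply: integrableS (@bounded_mfun_integrable f b c bf) => //.
  by apply: subset_itvr; rewrite bnd_simp.
by move=> <-; rewrite addrC subrK.
Qed.

(** The difference quotients are at most [K |h|], so the derivative is zero at every point. *)
Lemma quadratic_modulus_cst F (K : R) :
  (forall x y, x <= y -> `|F y - F x| <= K * (y - x) ^+ 2) -> forall x y, F x = F y.
Proof.
move=> FK x y; apply: is_derive_0_is_cst => {}x {y}.
have K0 : 0 <= K by have := FK 0 1 ler01; rewrite subr0 expr1n mulr1; exact: le_trans.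
have cv : h^-1 *: ((F \o shift x) h%:A - F x) @[h --> 0^'] --> (0 : R).
  apply/cvgrPdist_le => e e0; near=> h.
  rewrite sub0r normrN /= /GRing.scale/= mulr1 normrM.
  have h0 : 0 < `|h| by rewrite normr_gt0; near: h; exact: nbhs_dnbhs_neq.
  rewrite normfV ler_pdivrMl//.
  have : `|F (h + x) - F x| <= K * h ^+ 2.
    case: (leP 0 h) => hs.
      by have := FK x (h + x); rewrite lerDr addrK; exact.
    have := FK (h + x) x; rewrite gerDr (ltW hs) => /(_ isT).
    by rewrite distrC opprD addrCA subrr addr0 sqrrN.
  move=> /le_trans; apply; rewrite -real_normK ?num_real// expr2 mulrA mulrC.
  rewrite ler_pM2l//.
  (* [K] may be zero, hence the division by [K + 1]. *)
  have : `|h| <= e / (K + 1).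
    near: h; apply: dnbhs0_le; rewrite divr_gt0// ltr_wpDl//.
  rewrite ler_pdivlMr ?ltr_wpDl// => /(le_trans _); apply.
  by rewrite mulrC ler_wpM2l// lerDl.
split; first by apply/cvg_ex; exists 0.
exact/cvg_lim.
Unshelve. all: by end_near. Qed.

(* [f] need not be continuous, so [F] is in general only Lipschitz. *)
Definition primitive F f : Prop :=
  [/\ bounded_mfun F, bounded_mfun f &
      forall x y, x <= y -> intcc f x y = F y - F x].

Lemma intcc_lipschitz F f : bounded_mfun f ->
  (forall x y, x <= y -> intcc f x y = F y - F x) ->
  exists2 K : R, 0 < K & forall x y, `|F y - F x| <= K * `|y - x|.
Proof.
move=> bf Ff; have [K K0 fK] := bounded_mfun_gt0 bf; exists K => //.
suff H x y : x <= y -> `|F y - F x| <= K * `|y - x|.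
  move=> x y; have [|/ltW] := leP x y; first exact: H.
  by rewrite distrC (distrC y); exact: H.
move=> xy; rewrite -Ff// [`|y - x|]ger0_norm ?subr_ge0//.
by apply: intcc_bound => // z _; exact: fK.
Qed.

Lemma primitive_lipschitz F f : primitive F f ->
  exists2 K : R, 0 < K & forall x y, `|F y - F x| <= K * `|y - x|.
Proof. by move=> [_ bf Ff]; exact: intcc_lipschitz bf Ff. Qed.

Lemma primitiveZ (k : R) F f :
  primitive F f -> primitive (fun x => k * F x) (fun x => k * f x).
Proof.
move=> [bF bf Ff]; split; [exact: bounded_mfunZ|exact: bounded_mfunZ|].
by move=> x y xy; rewrite intccZ// Ff// mulrBr.
Qed.

Lemma primitiveD F f H h : primitive F f -> primitive H h ->
  primitive (fun x => F x + H x) (fun x => f x + h x).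
Proof.
move=> [bF bf Ff] [bH bh Hh]; split; [exact: bounded_mfunD|exact: bounded_mfunD|].
by move=> x y xy; rewrite intccD// Ff// Hh// opprD addrACA.
Qed.

(* Over [x, y] both sides differ by O((y - x)^2), which forces them to be equal. *)
Lemma primitiveM F f H h : primitive F f -> primitive H h ->
  primitive (fun x => F x * H x) (fun x => f x * H x + F x * h x).
Proof.
move=> pF pH.
have [K K0 FK] := primitive_lipschitz pF.
have [L L0 HL] := primitive_lipschitz pH.
case: pF pH => [bF bf Ff] [bH bh Hh].
set p := fun x => f x * H x + F x * h x.
have bp : bounded_mfun p by apply: bounded_mfunD; exact: bounded_mfunM.
split=> //; first exact: bounded_mfunM.
have [Kf Kf0 fKf] := bounded_mfun_gt0 bf.
have [Kh Kh0 hKh] := bounded_mfun_gt0 bh.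
have E x y : x <= y -> `|(F y * H y - F x * H x) - intcc p x y| <=
    (Kf * L + K * Kh) * (y - x) ^+ 2.
  move=> xy.
  (* In each term of the new integrand one factor is bounded and the other is O(y - x), because [F]
     and [H] are Lipschitz. *)
  have -> : (F y * H y - F x * H x) - intcc p x y =
      intcc (fun t => f t * (H y - H t) + (F x - F t) * h t) x y.
    have -> : (fun t => f t * (H y - H t) + (F x - F t) * h t) =
        (fun t => (H y * f t + F x * h t) - p t).
      by apply/funext => t; rewrite /p; ring.
    have bHf := bounded_mfunZ (H y) bf; have bFh := bounded_mfunZ (F x) bh.
    rewrite intccB//; last exact: bounded_mfunD.
    by rewrite (intccD _ _ bHf bFh) !intccZ// Ff// Hh//; ring.
  rewrite expr2 mulrA; apply: intcc_bound => //.
    by apply: bounded_mfunD; apply: bounded_mfunM => //; apply: bounded_mfunB => //;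
      exact: bounded_mfun_cst.
  move=> t /andP[xt ty]; rewrite (le_trans (ler_normD _ _))// [leRHS]mulrDl lerD//.
    rewrite normrM -mulrA ler_pM// (le_trans (HL _ _))// ler_pM2l//.
    by rewrite ger0_norm ?subr_ge0// lerB.
  rewrite normrM mulrAC ler_pM//.
  rewrite (le_trans (FK _ _))// ler_pM2l//.
  by rewrite ler0_norm ?subr_le0// opprB lerB.
move=> x y xy.
(* Freezing the defect to the left of [x] makes its quadratic estimate valid on the whole line, as
   [quadratic_modulus_cst] requires. *)
pose D z := if x <= z then F z * H z - intcc p x z else F x * H x - intcc p x x.
have D2 u v : u <= v -> `|D v - D u| <= (Kf * L + K * Kh) * (v - u) ^+ 2.
  move=> uv; rewrite /D; case: (leP x u) => xu.
    rewrite (le_trans xu uv) (intcc_chasles bp xu uv).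
    apply: le_trans (E _ _ uv); rewrite le_eqVlt; apply/orP; left; apply/eqP.
    by congr (`| _ |); ring.
  case: (leP x v) => xv; last first.
    by rewrite subrr normr0 mulr_ge0 ?sqr_ge0// addr_ge0// mulr_ge0// ltW.
  apply: (@le_trans _ _ ((Kf * L + K * Kh) * (v - x) ^+ 2)).
    apply: le_trans (E _ _ xv); rewrite le_eqVlt; apply/orP; left; apply/eqP.
    congr (`| _ |); suff -> : intcc p x x = 0 by ring.
    by rewrite /intcc set_itv1 Rintegral_set1.
  rewrite ler_wpM2l ?addr_ge0 ?mulr_ge0 ?(ltW K0) ?(ltW L0) ?(ltW Kf0) ?(ltW Kh0)//.
  rewrite ler_pXn2r// ?nnegrE ?subr_ge0// lerB// ltW//.
have := quadratic_modulus_cst D2 x y; rewrite /D lexx xy.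
have -> : intcc p x x = 0 by rewrite /intcc set_itv1 Rintegral_set1.
by move=> e; rewrite subr0 in e; rewrite e; ring.
Qed.

End BoundedMeasurable.

(** * Periodic functions, derivatives and antiderivatives *)

Section Calculus.
Context {R : realType}.
Local Notation mu := (@lebesgue_measure R).
Implicit Types (f h F H : R -> R) (a b x y T : R).

Lemma periodic_int f T (n : int) x : periodic f T -> f (x + T *~ n) = f x.
Proof.
move=> fT; case: n => n; first exact: periodicn.
by rewrite /intmul -[LHS](periodicn fT n.+1) subrK.
Qed.

Lemma periodic_reduce a x T : 0 < T ->
  exists n : int, a <= x + T *~ n < a + T.
Proof.
move=> T0; exists (- Num.floor ((x - a) / T)).
have /andP[] := floor_itv ((x - a) / T); set r := Num.floor _.
rewrite ler_pdivlMr// ltr_pdivrMr// intrD mulr1z mulrDl mul1r !mulrzl mulrNz.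
by move=> ? ?; apply/andP; split; lra.
Qed.

Lemma is_derive_continuous f (l : R) x : is_derive x 1 f l -> {for x, continuous f}.
Proof. by case=> df _; apply/differentiable_continuous/derivable1_diffP. Qed.

Lemma continuous_periodic_bounded f T :
  0 < T -> continuous f -> periodic f T -> bounded_mfun f.
Proof.
move=> T0 cf pf; split; first exact: continuous_measurable_fun.
have cn : {within `[0, T], continuous (fun x => `|f x|)}.
  by apply: continuous_subspaceT => x; apply: cvg_norm; exact: cf.
have [c _ cmax] := EVT_max (ltW T0) cn.
exists `|f c| => x; have [n /andP[n0 nT]] := periodic_reduce 0 x T0.
rewrite -(periodic_int n x pf); apply: cmax.
by rewrite in_itv/= n0 ltW// (lt_le_trans nT)// add0r.
Qed.

Lemma derive0_eq f a b : a <= b ->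
  (forall x, a < x < b -> is_derive x 1 f 0) -> {within `[a, b], continuous f} ->
  f a = f b.
Proof.
move=> ab df cf; have dfI z : z \in `]a, b[%R -> is_derive z 1 f 0.
  by rewrite in_itv/=; exact: df.
have [_ _] := @MVT_segment _ f (fun=> 0) a b ab dfI cf.
by rewrite mul0r => /eqP; rewrite subr_eq0 => /eqP.
Qed.

Lemma intcc_derive F f a b : continuous f -> (forall x, is_derive x 1 F (f x)) ->
  a <= b -> intcc f a b = F b - F a.
Proof.
move=> cf dF; rewrite le_eqVlt => /predU1P[->|ab].
  by rewrite /intcc set_itv1 Rintegral_set1 subrr.
have cF : continuous F by move=> z; exact: is_derive_continuous (dF z).
rewrite /intcc /Rintegral (continuous_FTC2 (F := F) ab)//.
- exact: continuous_subspaceT.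
- split; first by move=> z _; case: (dF z).
  + exact: cvg_at_right_filter (cF a).
  + exact: cvg_at_left_filter (cF b).
- by move=> z _; rewrite derive1E; case: (dF z).
Qed.

Lemma is_derive_primitive F f :
  bounded_mfun F -> bounded_mfun f -> continuous f ->
  (forall x, is_derive x 1 F (f x)) -> primitive F f.
Proof. by move=> bF bf cf dF; split=> // x y; exact: intcc_derive. Qed.

(** The endpoints are null, and on the open interval [h] inherits its measurability from [f]. *)
Lemma intcc_eq_oo f h a b : bounded_mfun f ->
  (forall x, a < x < b -> f x = h x) -> intcc f a b = intcc h a b.
Proof.
move=> [mf _] fh; rewrite /intcc /Rintegral.
have mfo : measurable_fun `]a, b[ (EFin \o f).
  by apply/measurable_EFinP; exact: measurable_funTS.
have mho : measurable_fun `]a, b[ (EFin \o h).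
  apply: eq_measurable_fun mfo => x; rewrite inE/= in_itv/= => xab.
  by rewrite (fh x xab).
congr fine.
rewrite (integral_itv_bndoo true false mfo) (integral_itv_bndoo true false mho).
by apply: eq_integral => x; rewrite inE/= in_itv/= => xab /=; rewrite (fh x xab).
Qed.

Lemma ex_antiderivative f : bounded_mfun f -> continuous f ->
  exists F, forall x, is_derive x 1 F (f x).
Proof.
move=> bf cf.
pose F x := if 0 <= x then intcc f 0 x else - intcc f x 0; exists F => x.
have FE y z : y <= z -> F z = F y + intcc f y z.
  move=> yz; rewrite /F; case: (leP 0 y) => y0.
    by rewrite (le_trans y0 yz); exact: intcc_chasles.
  case: (leP 0 z) => z0.
    by rewrite (intcc_chasles bf (ltW y0) z0) addKr.
  by rewrite (intcc_chasles bf yz (ltW z0)); ring.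
have xu : x < x + 1 by rewrite ltrDl.
have xl : x - 1 < x by rewrite gtrDl ltrN10.
(* The base point [x - 1] puts [x] inside the interval of integration, so one argument covers both
   signs of [x]. *)
have [dx ex] := continuous_FTC1_closed xu (@bounded_mfun_integrable _ f (x - 1) _ bf) xl (cf x).
apply: (@near_eq_is_derive _ _ _ (cst (F (x - 1)) + intcc f (x - 1))).
  near=> y; apply/esym/FE; apply/ltW; near: y; exact: lt_nbhsr.
rewrite -[f x]add0r; apply: is_deriveD.
by split; [exact: dx|rewrite -derive1E; exact: ex].
Unshelve. all: by end_near. Qed.

(** As a function of its base point, the increment has derivative [f (y + T) - f y = 0]. *)
Lemma antiderivative_increment F f T y z :
  (forall x, is_derive x 1 F (f x)) -> periodic f T ->
  F (y + T) - F y = F (z + T) - F z.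
Proof.
move=> dF pf; apply: (is_derive_0_is_cst (f := fun y => F (y + T) - F y)) => u.
have sh : is_derive u 1 (shift T) (1 : R) by exact: is_derive_shift.
have := @is_derive1_comp _ F (shift T) u _ _ (dF (shift T u)) sh.
by rewrite mulr1 /= pf => d1; have := is_deriveB d1 (dF u); rewrite subrr.
Qed.

Lemma derive1_periodic f T : periodic f T -> periodic (derive1 f) T.
Proof.
move=> pf x; rewrite /derive1.
have -> // : (fun h : R => h^-1 *: (f (h + (x + T)) - f (x + T))) =
             (fun h : R => h^-1 *: (f (h + x) - f x)).
by apply/funext => h; rewrite addrA !pf.
Qed.

Lemma lipschitz_continuous F (K : R) : 0 < K ->
  (forall x y, `|F y - F x| <= K * `|y - x|) -> continuous F.
Proof.
move=> K0 FK x; apply/cvgrPdist_le => e e0; near=> y.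
rewrite (le_trans (FK _ _))// mulrC -ler_pdivlMr//.
near: y; exists (e / K) => /=; first exact: divr_gt0.
by move=> z /= /ltW.
Unshelve. all: by end_near. Qed.

End Calculus.

(** * The du Bois-Reymond lemma on the circle *)

Section SmoothTerms.
Context {R : realType}.

(* Iterating [tderive] yields the sequence of derivatives required by [smooth]. *)
Inductive smooth_term : Type :=
| TVar | TCst of R
| TAdd of smooth_term & smooth_term | TMul of smooth_term & smooth_term
| TExp of smooth_term | TSin of smooth_term | TCos of smooth_term.

Fixpoint teval (e : smooth_term) (x : R) : R :=
  match e with
  | TVar => x
  | TCst c => c
  | TAdd e1 e2 => teval e1 x + teval e2 x
  | TMul e1 e2 => teval e1 x * teval e2 x
  | TExp e1 => expR (teval e1 x)
  | TSin e1 => sin (teval e1 x)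
  | TCos e1 => cos (teval e1 x)
  end.

Fixpoint tderive (e : smooth_term) : smooth_term :=
  match e with
  | TVar => TCst 1
  | TCst _ => TCst 0
  | TAdd e1 e2 => TAdd (tderive e1) (tderive e2)
  | TMul e1 e2 => TAdd (TMul e1 (tderive e2)) (TMul e2 (tderive e1))
  | TExp e1 => TMul (TExp e1) (tderive e1)
  | TSin e1 => TMul (TCos e1) (tderive e1)
  | TCos e1 => TMul (TMul (TCst (-1)) (TSin e1)) (tderive e1)
  end.

Lemma is_derive_teval (e : smooth_term) (x : R) : is_derive x 1 (teval e) (teval (tderive e) x).
Proof.
elim: e => /= [|c|e1 IH1 e2 IH2|e1 IH1 e2 IH2|e IH|e IH|e IH].
- exact: is_derive_id.
- exact: is_derive_cst.
- exact: is_deriveD.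
- exact: is_deriveM.
- exact: is_derive1_comp.
- exact: is_derive1_comp.
- by rewrite mulN1r; exact: is_derive1_comp.
Qed.

Lemma continuous_teval (e : smooth_term) : continuous (teval e).
Proof. by move=> x; exact: is_derive_continuous (is_derive_teval e x). Qed.

(** An antiderivative of a term need not be a term, but its derivatives of order at least one
    are. *)
Lemma smooth_antiderivative (phi : R -> R) (e : smooth_term) :
  (forall x : R, is_derive x 1 phi (teval e x)) -> smooth phi.
Proof.
move=> dphi; exists (fun n => if n is k.+1 then teval (iter k tderive e) else phi).
by split=> // -[|n] x //=; exact: is_derive_teval.
Qed.

End SmoothTerms.
Arguments smooth_term : clear implicits.

Section DuBoisReymond.
Context {R : realType}.
Local Notation mu := (@lebesgue_measure R).
Local Notation T := (2 * pi : R).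
Implicit Types (w : R -> R) (a b x : R).

Let T0 : 0 < T.
Proof. by rewrite mulr_gt0// pi_gt0. Qed.

(** Once its mean is subtracted, [e] has zero integral over a period, so its antiderivative is
    periodic and can serve as a test function. *)
Lemma test_fun_orthogonal_mean w (e : smooth_term R) :
  bounded_mfun w -> periodic (teval e) T ->
  (forall phi, test_fun phi -> intcc (fun x => w x * derive1 phi x) 0 T = 0) ->
  intcc (fun x => w x * teval e x) 0 T = intcc w 0 T / T * intcc (teval e) 0 T.
Proof.
move=> bw pe wphi.
have be : bounded_mfun (teval e).
  exact: continuous_periodic_bounded T0 (@continuous_teval _ e) pe.
pose c := intcc (teval e) 0 T / T.
have [phi dphi] : exists phi : R -> R, forall x, is_derive x 1 phi (teval (TAdd e (TCst (- c))) x).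
  apply: ex_antiderivative; last exact: continuous_teval.
  by apply: bounded_mfunD => //; exact: bounded_mfun_cst.
have phiT x : phi (x + T) = phi x.
  apply/eqP; rewrite -subr_eq0 (antiderivative_increment x 0 dphi _) ?add0r; last by move=> u /=; rewrite pe.
  rewrite -(intcc_derive (f := teval (TAdd e (TCst (- c))))) ?ltW//; last first.
    exact: continuous_teval.
  rewrite /= intccD//; last exact: bounded_mfun_cst.
  by rewrite intcc_cst ?ltW// subr0 /c mulNr divfK ?subrr// gt_eqF.
have tphi : test_fun phi by split=> //; exact: smooth_antiderivative dphi.
have := wphi _ tphi.
have -> : (fun x => w x * derive1 phi x) = (fun x => w x * teval e x - c * w x).
  by apply/funext => x; rewrite derive1E; case: (dphi x) => _ -> /=; ring.
rewrite intccB; [|exact: bounded_mfunM|exact: bounded_mfunZ].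
by rewrite intccZ// => /eqP; rewrite subr_eq0 => /eqP ->; rewrite /c; ring.
Qed.

(* [exp (- exp (- n u))] tends to the indicator function of [u > 0]; the function
   [u x = sin ((x - a) / 2) * sin ((b - x) / 2)] is [2 pi]-periodic and, on the circle,
   positive exactly between [a] and [b]. *)
Definition bump a b (n : nat) : smooth_term R :=
  let half e := TMul (TCst (2^-1)) e in
  let u := TMul (TSin (half (TAdd TVar (TCst (- a)))))
                (TSin (half (TAdd (TCst b) (TMul (TCst (-1)) TVar)))) in
  TExp (TMul (TCst (-1)) (TExp (TMul (TCst (- n%:R)) u))).

Let profile a b x : R := sin (2^-1 * (x - a)) * sin (2^-1 * (b - x)).

Lemma bumpE a b n x :
  teval (bump a b n) x = expR (- expR (- (n%:R * profile a b x))).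
Proof. by rewrite /= /profile !mulN1r mulNr. Qed.

Lemma bump_periodic a b n : periodic (teval (bump a b n)) T.
Proof.
move=> x; rewrite !bumpE; congr (expR (- expR (- (_ * _)))).
rewrite /profile.
have -> : 2^-1 * (x + T - a) = 2^-1 * (x - a) + pi by field.
have -> : 2^-1 * (b - (x + T)) = 2^-1 * (b - x) - pi by field.
by rewrite sinDpi sinB cospi sinpi mulr0 subr0 mulrN1 mulrNN.
Qed.

Lemma profile_gt0 a b x : 0 <= a -> b <= T -> a < x < b -> 0 < profile a b x.
Proof.
move=> a0 bT /andP[ax xb]; rewrite mulr_gt0// sin_gt0_pi//; apply/andP; split; lra.
Qed.

Lemma profile_lt0 a b x : 0 <= a -> a < b -> b <= T ->
  0 < x < a \/ b < x < T -> profile a b x < 0.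
Proof.
move=> a0 ab bT [/andP[x0 xa]|/andP[bx xT]]; rewrite /profile.
  have -> : 2^-1 * (x - a) = - (2^-1 * (a - x)) by field.
  rewrite sinN mulNr oppr_lt0.
  by rewrite mulr_gt0// sin_gt0_pi//; apply/andP; split; lra.
have -> : 2^-1 * (b - x) = - (2^-1 * (x - b)) by field.
rewrite sinN mulrN oppr_lt0.
by rewrite mulr_gt0// sin_gt0_pi//; apply/andP; split; lra.
Qed.

(** The pointwise limit of the bumps. At a zero of the profile every bump equals [expR (- 1)], so
    with this value the convergence holds at all points. *)
Let limbump a b x : R :=
  if 0 < profile a b x then 1 else if profile a b x < 0 then 0 else expR (- 1).

Lemma cvg_natmulr_pinfty (u : R) : 0 < u -> n%:R * u @[n --> \oo] --> +oo.
Proof.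
move=> u0; apply/cvgryPge => A.
have /cvgryPge/(_ (A / u)) := @cvgr_idn R.
by apply: filterS => n; rewrite ler_pdivrMr.
Qed.

Lemma cvg_bump a b x : teval (bump a b n) x @[n --> \oo] --> limbump a b x.
Proof.
have -> : (fun n => teval (bump a b n) x) =
    (fun n => expR (- expR (- (n%:R * profile a b x)))).
  by apply/funext => n; exact: bumpE.
rewrite /limbump; case: ltgtP => [u0|u0|<-].
- suff : expR (- expR (- (n%:R * profile a b x))) @[n --> \oo] --> expR (- 0 : R).
    by rewrite oppr0 expR0.
  apply: continuous_cvg; first exact: continuous_expR.
  apply: cvgN; exact: (cvg_comp _ _ (cvg_natmulr_pinfty u0) (@cvgr_expR R)).
- have cy : expR (- (n%:R * profile a b x)) @[n --> \oo] --> +oo.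
    apply/cvgryPge => A.
    have : n%:R * - profile a b x @[n --> \oo] --> +oo.
      by apply: cvg_natmulr_pinfty; rewrite oppr_gt0.
    move=> /cvgryPge/(_ A); apply: filterS => n; rewrite mulrN => /le_trans; apply.
    by apply: le_trans (expR_ge1Dx _); rewrite lerDr.
  exact: (cvg_comp _ _ cy (@cvgr_expR R)).
- under eq_fun do rewrite mulr0 oppr0 expR0.
  exact: cvg_cst.
Qed.

Lemma bump_le1 a b n x : `|teval (bump a b n) x| <= 1.
Proof.
by rewrite bumpE ger0_norm ?expR_ge0// -[leRHS]expR0 ler_expR oppr_le0 expR_ge0.
Qed.

Lemma bounded_mfun_bump a b n : bounded_mfun (teval (bump a b n)).
Proof.
split; last by exists 1; exact: bump_le1.
by apply: continuous_measurable_fun; exact: continuous_teval.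
Qed.

Lemma bounded_mfun_limbump a b : bounded_mfun (limbump a b).
Proof.
split.
  apply: (measurable_fun_cvg (h := fun n => teval (bump a b n))) => [n|x _].
    exact: (bounded_mfun_bump a b n).1.
  exact: cvg_bump.
exists 1 => x; rewrite /limbump; case: ifP => _; first by rewrite normr1.
case: ifP => _; first by rewrite normr0.
by rewrite ger0_norm ?expR_ge0// -[leRHS]expR0 ler_expR oppr_le0.
Qed.

(** Dominated convergence: the bumps are at most 1, so a bound of [|w|] dominates. *)
Lemma cvg_intcc_bump w a b : bounded_mfun w ->
  intcc (fun x => w x * teval (bump a b n) x) 0 T @[n --> \oo]
  --> intcc (fun x => w x * limbump a b x) 0 T.
Proof.
move=> bw; have [K K0 wK] := bounded_mfun_gt0 bw.
have bl := bounded_mfunM bw (bounded_mfun_limbump a b).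
have bn n := bounded_mfunM bw (bounded_mfun_bump a b n).
apply: fine_cvg; rewrite fineK ?intcc_EFin//.
have h1 n : measurable_fun `[0, T] (fun x => (w x * teval (bump a b n) x)%:E).
  by apply/measurable_EFinP; exact: measurable_funTS (bn n).1.
have h2 : measurable_fun `[0, T] (fun x => (w x * limbump a b x)%:E).
  by apply/measurable_EFinP; exact: measurable_funTS bl.1.
have h3 : {ae mu, forall x, `[0, T] x ->
    (w x * teval (bump a b n) x)%:E @[n --> \oo] --> (w x * limbump a b x)%:E}.
  apply: aeW => x _; apply: cvg_EFin; first exact: nearW.
  by apply: cvgMr; exact: cvg_bump.
have h4 := @bounded_mfun_integrable R _ 0 T (bounded_mfun_cst K).
have h5 : {ae mu, forall x n, `[0, T] x ->
    (`|(w x * teval (bump a b n) x)%:E| <= (EFin \o fun=> K) x)%E}.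
  apply: aeW => x n _; rewrite lee_fin normrM -[leRHS]mulr1.
  by rewrite ler_pM//; exact: bump_le1.
have [_ _] := @dominated_convergence _ _ R mu _ (measurable_itv _) _ _ _ h1 h2 h3 h4 h5.
by rewrite intcc_EFin.
Qed.

(** By the sign of the profile, on []0, T[] and away from [a] and [b], [limbump] is the indicator
    function of []a, b[]. *)
Lemma intcc_limbump w a b : bounded_mfun w -> 0 <= a -> a < b -> b <= T ->
  intcc (fun x => w x * limbump a b x) 0 T = intcc w a b.
Proof.
move=> bw a0 ab bT.
have bl := bounded_mfunM bw (bounded_mfun_limbump a b).
have aT := le_trans (ltW ab) bT.
rewrite (intcc_chasles bl a0 aT) (intcc_chasles bl (ltW ab) bT).
have zero c d : c <= d -> (forall x, c < x < d -> profile a b x < 0) ->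
    intcc (fun x => w x * limbump a b x) c d = 0.
  move=> cd neg; rewrite (intcc_eq_oo (h := fun=> 0))//.
    by rewrite intcc_cst// mul0r.
  move=> x /neg u0; rewrite /limbump u0 ltNge (ltW u0)/=; exact: mulr0.
rewrite zero//; last by move=> x ?; apply: profile_lt0 => //; left.
rewrite [X in _ + (_ + X)]zero//; last by move=> x ?; apply: profile_lt0 => //; right.
rewrite add0r addr0; apply: intcc_eq_oo => // x xab.
by rewrite /limbump profile_gt0// mulr1.
Qed.

(** Applied to bumps, [test_fun_orthogonal_mean] passes to the limit and yields the same identity
    for the indicator function of [[a, b]]. The constant is the mean of [w]. *)
Lemma du_bois_reymond_periodic w : bounded_mfun w ->
  (forall phi, test_fun phi -> intcc (fun x => w x * derive1 phi x) 0 T = 0) ->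
  exists C, forall a b, 0 <= a -> a <= b -> b <= T -> intcc w a b = C * (b - a).
Proof.
move=> bw wphi; exists (intcc w 0 T / T) => a b a0; rewrite le_eqVlt => /predU1P[->|ab] bT.
  by rewrite subrr mulr0 /intcc set_itv1 Rintegral_set1.
have c1 := @cvg_intcc_bump _ a b bw.
(* The weight 1 gives the limit [b - a] of the integrals of the bumps alone. *)
have c2 := @cvg_intcc_bump _ a b (bounded_mfun_cst 1).
rewrite intcc_limbump// in c1; rewrite intcc_limbump// in c2; last exact: bounded_mfun_cst.
rewrite intcc_cst ?(ltW ab)// mul1r in c2.
have {}c2 : intcc w 0 T / T * intcc (fun x => 1 * teval (bump a b n) x) 0 T @[n --> \oo]
    --> intcc w 0 T / T * (b - a).
  by apply: cvgM c2; exact: cvg_cst.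
have E : (fun n => intcc (fun x => w x * teval (bump a b n) x) 0 T) =
    (fun n => intcc w 0 T / T * intcc (fun x => 1 * teval (bump a b n) x) 0 T).
  apply/funext => n.
  rewrite (test_fun_orthogonal_mean bw (@bump_periodic a b n) wphi) /=.
  by congr (_ * intcc _ _ _); apply/funext => x; rewrite mul1r.
by rewrite E in c1; exact: cvg_unique c1 c2.
Qed.

End DuBoisReymond.

(** * The first integral *)

Section FirstIntegral.
Context {R : realType}.
Local Notation mu := (@lebesgue_measure R).
Local Notation T := (2 * pi : R).
Variables g G : R -> R.
Hypothesis bg : bounded_mfun g.
Hypothesis pG : periodic G T.
Hypothesis GgE : solves_resolvent g G.
Local Notation F := (derive1 G).

Let T0 : 0 < T.
Proof. by rewrite mulr_gt0// pi_gt0. Qed.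

Lemma resolvent_is_derive (x : R) : is_derive x 1 G (F x).
Proof. by rewrite derive1E; apply: derivableP; exact: GgE.1. Qed.

Lemma resolvent_bounded : bounded_mfun G.
Proof.
apply: continuous_periodic_bounded T0 _ pG => x.
exact: is_derive_continuous (resolvent_is_derive x).
Qed.

Let bf : bounded_mfun (fun t => g t - 4 * G t).
Proof. by apply: bounded_mfunB => //; exact/bounded_mfunZ/resolvent_bounded. Qed.

Lemma resolvent_intcc x y : x <= y ->
  intcc (fun t => g t - 4 * G t) x y = F y - F x.
Proof. by move=> xy; apply: EFin_inj; rewrite -intcc_EFin// -GgE.2. Qed.

Lemma resolvent_derive_lipschitz :
  exists2 K : R, 0 < K & forall x y, `|F y - F x| <= K * `|y - x|.
Proof. exact: intcc_lipschitz bf resolvent_intcc. Qed.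

Lemma resolvent_derive_continuous : continuous F.
Proof. by have [K K0] := resolvent_derive_lipschitz; exact: lipschitz_continuous. Qed.

Let bF : bounded_mfun F.
Proof.
exact: continuous_periodic_bounded T0 resolvent_derive_continuous (derive1_periodic pG).
Qed.

Let prF : primitive F (fun t => g t - 4 * G t).
Proof. by split=> //; exact: resolvent_intcc. Qed.

Let prG : primitive G F.
Proof.
apply: is_derive_primitive => //; first exact: resolvent_bounded.
  exact: resolvent_derive_continuous.
exact: resolvent_is_derive.
Qed.

Lemma test_fun_primitive (phi : R -> R) : test_fun phi -> primitive phi (derive1 phi).
Proof.
move=> [[d [d0 dd]] pphi].
have dphi (x : R) : is_derive x 1 phi (derive1 phi x).
  by rewrite derive1E -d0; apply: derivableP; case: (dd 0%N x).
have d1 : derive1 phi = d 1%N.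
  by apply/funext => x; rewrite derive1E -d0; case: (dd 0%N x).
have c0 : continuous phi by move=> x; exact: is_derive_continuous (dphi x).
have c1 : continuous (derive1 phi).
  by rewrite d1 => x; exact: is_derive_continuous (dd 1%N x).
apply: is_derive_primitive => //.
  exact: continuous_periodic_bounded T0 c0 pphi.
exact: continuous_periodic_bounded T0 c1 (derive1_periodic pphi).
Qed.

Hypothesis gG0 : steady_eq g G.

(* [2 G^2 + F^2 / 2] is a primitive of [F g], so the equation reads
   [(G g - 2 G^2 - F^2 / 2)' = 0]. *)
Lemma steady_flux : exists C, forall a b, 0 <= a -> a <= b -> b <= T ->
  intcc (fun t => G t * g t - (2 * (G t * G t) + 2^-1 * (F t * F t))) a b = C * (b - a).
Proof.
have bG := resolvent_bounded.
set v := fun t => 2 * (G t * G t) + 2^-1 * (F t * F t).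
have prv : primitive v (fun t => F t * g t).
  have -> : (fun t => F t * g t) = (fun t => 2 * (F t * G t + G t * F t) +
      2^-1 * ((g t - 4 * G t) * F t + F t * (g t - 4 * G t))).
    by apply/funext => t; field.
  exact: primitiveD (primitiveZ 2 (primitiveM prG prG)) (primitiveZ 2^-1 (primitiveM prF prF)).
have [bv _ _] := (prv).
have pv : periodic v T.
  by move=> x; rewrite /v pG (derive1_periodic pG).
apply: du_bois_reymond_periodic.
  by apply: bounded_mfunB => //; exact: bounded_mfunM.
move=> phi tphi; have prphi := test_fun_primitive tphi.
have [bphi bphi' _] := (prphi).
(* [v phi] is periodic, so [F g phi + v phi'] integrates to zero over a period. Subtracting it from
   the weak form leaves [(G g - v) phi']. *)
have [_ bq qE] := primitiveM prv prphi.
have := qE _ _ (ltW T0); rewrite -[T in v T]add0r -[T in phi T]add0r pv tphi.2 subrr => q0.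
have bs : bounded_mfun (fun t => G t * g t * derive1 phi t + F t * g t * phi t).
  by apply: bounded_mfunD; do 2?apply: bounded_mfunM.
have := gG0 tphi; rewrite intcc_EFin// => -[s0].
have := intccB 0 T bs bq; rewrite s0 q0 subrr => E; rewrite -[RHS]E.
by apply: (congr1 (fun u => intcc u 0 T)); apply/funext => t; rewrite /v; ring.
Qed.

(** A priori [G F] is only Lipschitz, a primitive of [F^2 + G (g - 4 G)]. By [steady_flux] this
    integrand has the same integrals as a continuous function [k], so [G F] differs from an
    antiderivative of [k] by a constant and is [C^1]. *)
Lemma steady_first_integral : exists C : R, forall x : R,
  is_derive x 1 (fun t => G t * F t) (3 / 2 * F x ^+ 2 - 2 * G x ^+ 2 + C).
Proof.
have [C fluxC] := steady_flux; exists C.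
have bG := resolvent_bounded.
pose k t := 3 / 2 * (F t * F t) - 2 * (G t * G t) + C.
have pF := derive1_periodic pG.
have ck : continuous k.
  move=> x; apply: cvgD; last exact: cvg_cst.
  apply: cvgB; (apply: cvgM; first exact: cvg_cst); apply: cvgM.
  - exact: resolvent_derive_continuous.
  - exact: resolvent_derive_continuous.
  - exact: is_derive_continuous (resolvent_is_derive x).
  - exact: is_derive_continuous (resolvent_is_derive x).
have pk : periodic k T by move=> x; rewrite /k pF pG.
have bk := continuous_periodic_bounded T0 ck pk.
have [P dP] := ex_antiderivative bk ck.
have [_ be Ee] := primitiveM prG prF.
pose D t := G t * F t - P t.
have D0 a b : 0 <= a -> a <= b -> b <= T -> D b = D a.
  move=> a0 ab bT.
  have bw : bounded_mfun (fun t => G t * g t - (2 * (G t * G t) + 2^-1 * (F t * F t))).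
    by apply: bounded_mfunB; [|apply: bounded_mfunD; apply: bounded_mfunZ];
      exact: bounded_mfunM.
  have : intcc (fun t => F t * F t + G t * (g t - 4 * G t)) a b = intcc k a b.
    apply/eqP; rewrite -subr_eq0 -intccB//.
    have -> : (fun t => F t * F t + G t * (g t - 4 * G t) - k t) =
       (fun t => G t * g t - (2 * (G t * G t) + 2^-1 * (F t * F t)) - C).
      by apply/funext => t; rewrite /k; field.
    rewrite intccB//; last exact: bounded_mfun_cst.
    by rewrite fluxC// intcc_cst// subrr.
  rewrite Ee// (intcc_derive ck dP ab) => e.
  by rewrite /D -[G b * F b](subrK (G a * F a)) e; ring.
(* So far [D] is known to be constant on [[0, 2 pi]] only. There the increment of [P] is zero, as
   [G F] is periodic, and increments of [P] over a period do not depend on the base point. *)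
have pD : periodic D T.
  move=> x; rewrite /D pG pF; congr (_ - _); apply/eqP; rewrite -subr_eq0.
  rewrite (antiderivative_increment x 0 dP pk) add0r.
  have := D0 _ _ (lexx 0) (ltW T0) (lexx T).
  rewrite /D -[T in G T]add0r -[T in F T]add0r pG pF => /addrI/oppr_inj ->.
  by rewrite subrr.
have DE x : D x = D 0.
  have [n /andP[n0 nT]] := periodic_reduce 0 x T0.
  by rewrite -(periodic_int n x pD); apply: D0 => //; rewrite -[leRHS]add0r ltW.
move=> x; rewrite !expr2; have -> : (fun t => G t * F t) = P + cst (D 0).
  by apply/funext => t; rewrite -[RHS]/(P t + D 0) -(DE t) /D; ring.
by rewrite -[X in is_derive _ _ _ X]addr0; apply: is_deriveD; exact: dP.
Qed.

End FirstIntegral.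

(** * Arcs between zeros *)

Section Zeros.
Context {R : realType}.
Implicit Types (f : R -> R) (x y z : R).

(** Take the supremum of the zeros in [[z, x]]. Zeros adhere to it, whereas a continuous function
    has no zeros near a point where it is nonzero. *)
Lemma last_zero_le f z x : continuous f -> z <= x -> f z = 0 ->
  exists a, [/\ z <= a, a <= x, f a = 0 & forall y, a < y <= x -> f y != 0].
Proof.
move=> cf zx fz; pose A := [set y | z <= y <= x /\ f y = 0].
have Az : A z by split=> //; rewrite lexx.
have uA : ubound A x by move=> y [/andP[]].
have sA : has_sup A by split; [exists z|exists x].
have zs : z <= sup A by apply: sup_upper_bound.
have sx : sup A <= x by apply: sup_le_ub => //; exists z.
exists (sup A); split=> //; last first.
  move=> y /andP[sy yx]; apply/eqP => fy; have := sy; rewrite ltNge => /negP; apply.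
  by apply: sup_upper_bound => //; split=> //; rewrite yx (le_trans zs (ltW sy)).
apply/eqP; apply: contrapT => /negP fs.
have /cvgr_neq0/(_ fs) [e /= e0 ne] := cf (sup A).
have [y Ay sy] := sup_adherent e0 sA.
have ys : y <= sup A by exact: sup_upper_bound.
have : f y != 0.
  by apply: ne => /=; rewrite ger0_norm ?subr_ge0//; lra.
by move: Ay => [_ ->]; rewrite eqxx.
Qed.

(** The mirror image of [last_zero_le] under [y -> - y]. *)
Lemma first_zero_ge f z x : continuous f -> x <= z -> f z = 0 ->
  exists b, [/\ x <= b, b <= z, f b = 0 & forall y, x <= y < b -> f y != 0].
Proof.
move=> cf xz fz.
have cfN : continuous (fun y => f (- y)).
  by move=> y; apply: (@continuous_comp _ _ _ -%R f); [exact: opp_continuous|exact: cf].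
have [||b [b1 b2 b3 b4]] := @last_zero_le (fun y => f (- y)) (- z) (- x) cfN.
- by rewrite lerN2.
- by rewrite opprK.
exists (- b); split=> //; [lra|lra|].
move=> y /andP[xy yb]; rewrite -(opprK y); apply: b4; apply/andP; split; lra.
Qed.

(** Cut [[a, b]] into cells of length [d]: a cell contains at most one point of [A], so the cell
    number is injective on [A], with bounded values. *)
Lemma finite_separated (A : set R) (a b d : R) : 0 < d ->
  A `<=` `[a, b] -> (forall x y, A x -> A y -> x < y -> d <= y - x) ->
  finite_set A.
Proof.
move=> d0 Aab sepA.
pose f x := Num.truncn ((x - a) / d).
have fP x : A x -> (f x)%:R <= (x - a) / d < (f x).+1%:R.
  move=> /Aab /=; rewrite in_itv/= => /andP[ax _].
  by apply: truncn_itv; rewrite divr_ge0 ?subr_ge0// ltW.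
have lt x y : A x -> A y -> x < y -> f x <> f y.
  move=> Ax Ay xy fxy; have dxy := sepA _ _ Ax Ay xy.
  have /andP[] := fP _ Ax; have /andP[] := fP _ Ay; rewrite fxy -natr1.
  rewrite ler_pdivlMr// ltr_pdivrMr// => ? ?; rewrite ler_pdivlMr// ltr_pdivrMr// => ? ?.
  by lra.
have injf : {in A &, injective f}.
  move=> x y; rewrite !inE => Ax Ay fxy; apply/eqP; rewrite eq_le !leNgt.
  apply/andP; split; apply/negP => xy.
    exact: lt Ay Ax xy (esym fxy).
  exact: lt Ax Ay xy fxy.
rewrite -(eq_finite_set (inj_card_eq injf)).
apply: (sub_finite_set (B := `I_(Num.truncn ((b - a) / d)).+1)); last exact: finite_II.
move=> _ [x Ax <-] /=; rewrite ltnS; apply: le_truncn.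
move: (Aab _ Ax); rewrite /= in_itv/= => /andP[_ xb].
by rewrite ler_pM2r ?invr_gt0// lerB.
Qed.

End Zeros.

Section Arcs.
Context {R : realType}.
Variables (G F : R -> R) (C : R).
Hypothesis dG : forall x : R, is_derive x 1 G (F x).
Hypothesis cF : continuous F.
Hypothesis dGF : forall x : R,
  is_derive x 1 (fun t => G t * F t) (3 / 2 * F x ^+ 2 - 2 * G x ^+ 2 + C).
Implicit Types a b x : R.

Let cG : continuous G.
Proof. by move=> x; exact: is_derive_continuous (dG x). Qed.

(* The value of [g = 4 G + G''] away from the zeros of [G]. *)
Definition vorticity x := (F x ^+ 2 / 2 + 2 * G x ^+ 2 + C) / G x.

(* At a zero of [G], the derivative of [G F] computed directly is [F^2]. *)
Lemma speed_at_zero x : G x = 0 -> F x ^+ 2 = - 2 * C.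
Proof.
move=> Gx; have dq : is_derive x 1 (fun t => G t * F t) (F x * F x).
  have cv : h^-1 *: (((fun t => G t * F t) \o shift x) h%:A - G x * F x) @[h --> 0^'] --> F x * F x.
    (* As [G x = 0], the difference quotient of [G F] is that of [G] times [F (h + x)], and
       continuity of [F] suffices for the limit. *)
    have -> : (fun h : R => h^-1 *: (((fun t => G t * F t) \o shift x) h%:A - G x * F x)) =
       (fun h => h^-1 *: ((G \o shift x) h%:A - G x) * F (h + x)).
      apply/funext => h /=; rewrite Gx mul0r !subr0 /GRing.scale/= mulr1; ring.
    apply: cvgM.
      by have [dGx <-] := dG x; exact: dGx.
    have -> : (fun h : R => F (h + x)) = F \o shift x by [].
    apply: (@cvg_comp _ _ _ (shift x) F _ (nbhs x)); last exact: cF.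
    have sx : h + x @[h --> (0 : R)] --> (0 + x : R).
      by apply: cvgD; [exact: cvg_id|exact: cvg_cst].
    by rewrite add0r in sx; exact: cvg_within_filter sx.
  by split; [apply/cvg_ex; exists (F x * F x)|exact/cvg_lim].
have := dGF x; rewrite Gx; case=> _ e1; case: dq => _ e2; move: e1; rewrite e2 => e.
by rewrite !expr2 in e *; lra.
Qed.

(** Near [x], [F] is the quotient of the differentiable functions [G F] and [G]. *)
Lemma is_derive_speed x : G x != 0 -> is_derive x 1 F (vorticity x - 4 * G x).
Proof.
move=> Gx.
have dV : is_derive x 1 (fun t => (G t)^-1) (- (G x) ^- 2 *: F x) by exact: is_deriveV.
have dQ := is_deriveM (dGF x) dV.
have nF : \forall t \near x, ((fun t => G t * F t) * (fun t => (G t)^-1)) t = F t.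
  have /cvgr_neq0/(_ Gx) := @cG x; apply: filterS => t Gt.
  by rewrite /= -[LHS]/(G t * F t * (G t)^-1) mulrAC divff ?mul1r.
apply: near_eq_is_derive nF _; apply: is_derive_eq dQ _.
by rewrite /vorticity /GRing.scale/=; field.
Qed.

(** The derivative of the numerator is [F] times the vorticity, so the two terms of the quotient
    rule cancel. *)
Lemma is_derive_vorticity x : G x != 0 -> is_derive x 1 vorticity 0.
Proof.
move=> Gx; have dV : is_derive x 1 (fun t => (G t)^-1) (- (G x) ^- 2 *: F x) by exact: is_deriveV.
have dF := is_derive_speed Gx.
have dN : is_derive x 1 (fun t => F t ^+ 2 / 2 + 2 * G t ^+ 2 + C)
    (F x * (vorticity x - 4 * G x) + 4 * (G x * F x)).
  have d1 := is_deriveZ 2^-1 (is_deriveM dF dF).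
  have d2 := is_deriveZ 2 (is_deriveM (dG x) (dG x)).
  have d3 := is_deriveD (is_deriveD d1 d2) (is_derive_cst C x (1 : R)).
  have -> : (fun t => F t ^+ 2 / 2 + 2 * G t ^+ 2 + C) =
     2^-1 \*: (F * F) + 2 \*: (G * G) + cst C.
    by apply/funext => t; rewrite -[RHS]/(2^-1 * (F t * F t) + 2 * (G t * G t) + C); field.
  by apply: is_derive_eq d3 _; rewrite /GRing.scale/=; field.
apply: is_derive_eq (is_deriveM dN dV) _.
by rewrite /vorticity /GRing.scale/=; field.
Qed.

Lemma vorticity_cst a b x y : (forall t, a < t < b -> G t != 0) ->
  a < x -> x <= y -> y < b -> vorticity x = vorticity y.
Proof.
move=> Gn ax xy yb.
have dv t : x <= t <= y -> is_derive t 1 vorticity 0.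
  by move=> /andP[xt ty]; apply/is_derive_vorticity/Gn; rewrite (lt_le_trans ax)// (le_lt_trans ty).
apply: derive0_eq => // [t /andP[xt ty]|]; first by apply: dv; rewrite !ltW.
apply/continuous_in_subspaceT => t; rewrite inE/= in_itv/= => xty.
exact: is_derive_continuous (dv _ xty).
Qed.

Let phase (x t : R) := 2 * (x - t).

Let is_derive_phase (x t : R) : is_derive t 1 (phase x) (- 2).
Proof.
have := is_deriveZ 2 (is_deriveB (is_derive_cst x t (1 : R)) (is_derive_id t (1 : R))).
by rewrite sub0r scalerN /GRing.scale/= mulr1.
Qed.

Let is_derive_sin_phase (x t : R) :
  is_derive t 1 (fun t => sin (phase x t)) (- 2 * cos (phase x t)).
Proof.
by rewrite mulrC; exact: is_derive1_comp (is_derive_sin _) (is_derive_phase x t).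
Qed.

Let is_derive_cos_phase (x t : R) :
  is_derive t 1 (fun t => cos (phase x t)) (2 * sin (phase x t)).
Proof.
rewrite -[2 * _]mulrNN mulrC; exact: is_derive1_comp (is_derive_cos _) (is_derive_phase x t).
Qed.

(* Variation of constants for [G'' + 4 G = c]. *)
Lemma arc_formula a b x : G a = 0 -> (forall t, a < t < b -> G t != 0) ->
  a <= x <= b -> let c := vorticity ((a + b) / 2) in let s := x - a in
  2 * G x = F a * sin (2 * s) + c / 2 * (1 - cos (2 * s)) /\
  F x = F a * cos (2 * s) + c / 2 * sin (2 * s).
Proof.
move=> Ga Gn /andP[ax xb] c s.
(* [G] may vanish at both ends, so the constant value of the vorticity is sampled at the
   midpoint. *)
have dF t : a < t < x -> is_derive t 1 F (c - 4 * G t).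
  move=> /andP[at_ tx]; have tb := lt_le_trans tx xb.
  have -> : c = vorticity t.
    case: (leP t ((a + b) / 2)) => tm.
      by apply/esym; apply: (vorticity_cst Gn) => //; lra.
    by apply: (vorticity_cst Gn); lra.
  by apply/is_derive_speed/Gn; rewrite at_.
have cs : continuous (fun t => sin (phase x t)).
  by move=> t; exact: is_derive_continuous (is_derive_sin_phase x t).
have cc : continuous (fun t => cos (phase x t)).
  by move=> t; exact: is_derive_continuous (is_derive_cos_phase x t).
have px : phase x x = 0 by rewrite /phase subrr mulr0.
split.
(* The pair [(2 G - c / 2, F)] rotates at angular speed 2. [S t] is the first coordinate of its
   state at [t] carried forward to [x], hence independent of [t]; the second half of the proof
   treats the coordinate [F] likewise. *)
- pose S t := F t * sin (phase x t) + (2 * G t - c / 2) * cos (phase x t).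
  suff : S a = S x.
    by rewrite /S px sin0 cos0 Ga -/(phase x a) /s -/(phase x a) => e; rewrite -/(phase x a); lra.
  apply: derive0_eq => // [t atx|].
    have dH := is_deriveB (is_deriveZ 2 (dG t)) (is_derive_cst (c / 2) t (1 : R)).
    have d := is_deriveD (is_deriveM (dF t atx) (is_derive_sin_phase x t))
      (is_deriveM dH (is_derive_cos_phase x t)).
    by apply: is_derive_eq d _; rewrite /GRing.scale/= -[(_ - _) t]/(2 * G t - c / 2); field.
  apply: continuous_subspaceT => t; apply: cvgD; apply: cvgM; try exact: cF; try exact: cs; try exact: cc.
  by apply: cvgB; [apply: cvgM; [exact: cvg_cst|exact: cG]|exact: cvg_cst].
- pose S t := F t * cos (phase x t) + (c / 2 - 2 * G t) * sin (phase x t).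
  suff : S a = S x.
    by rewrite /S px sin0 cos0 Ga /s -/(phase x a) => e; lra.
  apply: derive0_eq => // [t atx|].
    have dH := is_deriveB (is_derive_cst (c / 2) t (1 : R)) (is_deriveZ 2 (dG t)).
    have d := is_deriveD (is_deriveM (dF t atx) (is_derive_cos_phase x t))
      (is_deriveM dH (is_derive_sin_phase x t)).
    by apply: is_derive_eq d _; rewrite /GRing.scale/= -[(_ - _) t]/(c / 2 - 2 * G t); field.
  apply: continuous_subspaceT => t; apply: cvgD; apply: cvgM; try exact: cF; try exact: cs; try exact: cc.
  by apply: cvgB; [exact: cvg_cst|apply: cvgM; [exact: cvg_cst|exact: cG]].
Qed.

Lemma sin_double (u : R) : sin (2 * u) = 2 * (sin u * cos u).
Proof. by rewrite mulrC mulr_natr sin_mulr2n mulr2n; ring. Qed.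

Lemma cos_double (u : R) : cos (2 * u) = cos u ^+ 2 - sin u ^+ 2.
Proof. by rewrite mulrC mulr_natr mulr2n cosD !expr2. Qed.

Section Arc.
Variables a b : R.
Hypotheses (ab : a < b) (bpi : b - a <= pi / 2) (Ga : G a = 0) (Gb : G b = 0).
Hypothesis Gn : forall t, a < t < b -> G t != 0.
Local Notation c := (vorticity ((a + b) / 2)).
Local Notation L := (b - a).

Let sL : 0 < sin L.
Proof.
move: (ab) (bpi) (pi_gt0 R) => ab' bpi' pi0.
by apply: sin_gt0_pi; apply/andP; split; lra.
Qed.

(** Since [G b = 0], the arc formula at [b] factors as [sin L * (2 * F a * cos L + c * sin L) = 0],
    and [sin L > 0] because [0 < L <= pi / 2]. *)
Lemma arc_vorticity : c * sin L = - 2 * F a * cos L.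
Proof.
have [+ _] := arc_formula Ga Gn (x := b) (introT andP (conj (ltW ab) (lexx b))).
rewrite Gb mulr0 sin_double cos_double => e.
have : sin L * (2 * F a * cos L + c * sin L) = 0.
  by rewrite [RHS]e cos2sin2; field.
by move/eqP; rewrite mulf_eq0 gt_eqF//= => /eqP; lra.
Qed.

(** In the arc formula for [F b] the first term is [F a (2 cos^2 L - 1)] and, by [arc_vorticity],
    the second is [- 2 F a cos^2 L]. *)
Lemma arc_end_speed : F b = - F a.
Proof.
have [_ ->] := arc_formula Ga Gn (x := b) (introT andP (conj (ltW ab) (lexx b))).
rewrite sin_double cos_double.
have -> : c / 2 * (2 * (sin L * cos L)) = c * sin L * cos L by field.
by rewrite arc_vorticity sin2cos2; ring.
Qed.

(** If [F a = 0] then [c = 0] by [arc_vorticity], and the arc formula makes [G] vanish at the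
    midpoint. *)
Lemma arc_speed_neq0 : F a != 0.
Proof.
move: (ab) => ab'; apply/eqP => Fa0; have := arc_vorticity; rewrite Fa0 mulr0 mul0r => /eqP.
rewrite mulf_eq0 (gt_eqF sL) orbF => /eqP c0.
have m : a <= (a + b) / 2 <= b by apply/andP; split; lra.
have [] := arc_formula Ga Gn m.
rewrite c0 Fa0 !mul0r addr0 => /eqP; rewrite mulf_eq0 pnatr_eq0/= => /eqP Gm _.
have : G ((a + b) / 2) != 0 by apply: Gn; apply/andP; split; lra.
by rewrite Gm eqxx.
Qed.

(** With [u = b - x] and [v = x - a], the arc formula becomes
    [F x * sin (u + v) = F a * sin (u - v)]. For [u], [v] in [[0, pi / 2]] all sines and cosines are
    nonnegative, so [|sin (u - v)| <= sin (u + v)]. *)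
Lemma arc_speed_le x : a <= x <= b -> `|F x| <= `|F a|.
Proof.
move=> axb; have [_ Fx] := arc_formula Ga Gn axb.
move: axb (ab) (bpi) (pi_gt0 R) => /andP[ax xb] ab' bpi' pi0.
rewrite -(ler_pM2r sL) -[X in _ * X <= _](gtr0_norm sL) -normrM.
have -> : F x * sin L = F a * sin ((b - x) - (x - a)).
  have -> : (b - x) - (x - a) = L - 2 * (x - a) by ring.
  rewrite Fx [sin (L - _)]sinB mulrDl.
  have -> : c / 2 * sin (2 * (x - a)) * sin L = c * sin L / 2 * sin (2 * (x - a)) by ring.
  by rewrite arc_vorticity; field.
rewrite normrM ler_wpM2l//.
have -> : L = (b - x) + (x - a) by ring.
have s1 : 0 <= sin (b - x) by apply: sin_ge0_pi; apply/andP; split; lra.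
have s2 : 0 <= sin (x - a) by apply: sin_ge0_pi; apply/andP; split; lra.
have c1 : 0 <= cos (b - x) by apply: cos_ge0_pihalf; apply/andP; split; lra.
have c2 : 0 <= cos (x - a) by apply: cos_ge0_pihalf; apply/andP; split; lra.
move: (b - x) (x - a) s1 s2 c1 c2 => u v s1 s2 c1 c2.
rewrite sinB sinD ler_norml.
have := mulr_ge0 s1 c2; have := mulr_ge0 c1 s2 => ? ?.
by apply/andP; split; lra.
Qed.

(** The strict bound gives [cos L > 0] in [c F a sin L = - 2 F a^2 cos L]. *)
Lemma arc_vorticity_sign : b - a < pi / 2 -> c * F a < 0.
Proof.
move: (ab) (pi_gt0 R) => ab' pi0 Lpi.
have cL : 0 < cos L by apply: cos_gt0_pihalf; apply/andP; split; lra.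
rewrite -(pmulr_llt0 _ sL) mulrAC arc_vorticity.
have F2 : 0 < F a ^+ 2 by rewrite exprn_even_gt0//= arc_speed_neq0.
have -> : - 2 * F a * cos L * F a = - (2 * (cos L * F a ^+ 2)) by ring.
by rewrite oppr_lt0 mulr_gt0// mulr_gt0.
Qed.

End Arc.

End Arcs.

(** * The structure of bounded solutions *)

Section AlmostEverywhere.
Context {R : realType}.
Local Notation mu := (@lebesgue_measure R).
Implicit Types (f : R -> R) (a b : R).

Lemma bounded_mfun_locally_integrable f : bounded_mfun f -> locally_integrable [set: R] f.
Proof.
move=> [mf [K fK]]; split=> //; first exact: openT.
move=> A _ cA; have mA := compact_measurable cA.
apply: (@le_lt_trans _ _ (\int[mu]_(x in A) (cst K%:E) x)%E).
  apply: ge0_le_integral => //=.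
  - by apply/measurable_EFinP/measurableT_comp => //; exact: measurable_funTS.
  - by move=> x _; rewrite lee_fin (le_trans _ (fK x)).
have K0 : 0 <= K := le_trans (normr_ge0 _) (fK 0).
rewrite integral_cst//; apply: lte_mul_pinfty; rewrite ?lee_fin//.
exact: compact_finite_measure.
Qed.

Lemma ae_imply (P Q : R -> Prop) : (forall x, P x -> Q x) ->
  {ae mu, forall x, P x} -> {ae mu, forall x, Q x}.
Proof.
move=> PQ [N [mN N0 PN]]; exists N; split=> // x nQ.
by apply: PN => Px; exact/nQ/PQ.
Qed.

(** Lebesgue differentiation: almost everywhere [f] is the derivative of its indefinite integral,
    which vanishes here. *)
Lemma ae_eq0_itv f a b : bounded_mfun f ->
  (forall x, a <= x <= b -> intcc f a x = 0) ->
  {ae mu, forall x, a < x < b -> f x = 0}.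
Proof.
move=> bf f0.
have := @FTC1 R f (BLeft a) (fun y => bounded_mfun_integrable a y bf) (bounded_mfun_locally_integrable bf).
apply: ae_imply => x H /andP[ax xb].
have [|_ <-] := H; first by rewrite lte_fin.
have [_] : is_derive x 1 (intcc f a) 0; last by rewrite -derive1E.
apply: near_eq_is_derive _ (is_derive_cst (0 : R) x (1 : R)).
near=> y; apply/esym/f0; apply/andP; split; apply: ltW; near: y.
  exact: lt_nbhsr.
exact: lt_nbhsl.
Unshelve. all: by end_near. Qed.

Lemma ae_forall_itv (P : R -> Prop) :
  (forall n : nat, {ae mu, forall x : R, - n%:R < x < n%:R -> P x}) -> {ae mu, forall x, P x}.
Proof.
move=> /ae_foralln; apply: ae_imply => x /(_ (Num.truncn `|x|).+1); apply.
by rewrite -ltr_norml; have /andP[] := truncn_itv (normr_ge0 x).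
Qed.

End AlmostEverywhere.

Section Structure.
Context {R : realType}.
Local Notation mu := (@lebesgue_measure R).
Local Notation T := (2 * pi : R).
Variables (g G : R -> R) (p : R).
Hypothesis bg : bounded_mfun g.
Hypotheses (p0 : 0 < p) (ppi : p <= pi / 2).
Hypotheses (pG : periodic G p) (pGT : periodic G T).
Hypotheses (GgE : solves_resolvent g G) (gG0 : steady_eq g G).
Local Notation F := (derive1 G).

Let dG := resolvent_is_derive GgE.
Let cF : continuous F := resolvent_derive_continuous bg pGT GgE.
Let cG : continuous G.
Proof. by move=> x; exact: is_derive_continuous (dG x). Qed.
Let pF : periodic F p := derive1_periodic pG.
Let pFT : periodic F T := derive1_periodic pGT.

Variable C : R.
Hypothesis dGF : forall x : R,
  is_derive x 1 (fun t => G t * F t) (3 / 2 * F x ^+ 2 - 2 * G x ^+ 2 + C).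
Local Notation vort := (vorticity G F C).

(** On a zero-free interval the increments of [F] are integrals of [c - 4 G] by the classical
    derivative and of [g - 4 G] by the resolvent equation, so [g - c] has zero integral over every
    [[a, x]]. *)
Lemma vorticity_ae (a b : R) : (forall t, a < t < b -> G t != 0) ->
  {ae mu, forall x, a < x < b -> g x = vort ((a + b) / 2)}.
Proof.
move=> Gn; set c := vort _.
have bgc : bounded_mfun (fun t => g t - c) by apply: bounded_mfunB => //; exact: bounded_mfun_cst.
have bG := resolvent_bounded pGT GgE.
have b4G : bounded_mfun (fun t => 4 * G t) by exact: bounded_mfunZ.
suff H : {ae mu, forall x, a < x < b -> g x - c = 0}.
  by apply: ae_imply H => x H /H /eqP; rewrite subr_eq0 => /eqP.
apply: ae_eq0_itv => // x /andP[]; rewrite le_eqVlt => /predU1P[<-|ax] xb.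
  by rewrite /intcc set_itv1 Rintegral_set1.
have cont : continuous (fun t => c - 4 * G t).
  by move=> t; apply: cvgB; [exact: cvg_cst|apply: cvgM; [exact: cvg_cst|exact: cG]].
have dF (t : R) : a < t < x -> is_derive t 1 F (c - 4 * G t).
  move=> /andP[at_ tx]; have tb := lt_le_trans tx xb.
  have -> : c = vort t.
    case: (leP t ((a + b) / 2)) => tm.
      by apply/esym; apply: (vorticity_cst dG dGF Gn) => //; lra.
    by apply: (vorticity_cst dG dGF Gn); lra.
  by apply: (is_derive_speed dG dGF); apply: Gn; rewrite at_.
have e1 : intcc (fun t => c - 4 * G t) a x = F x - F a.
  rewrite /intcc /Rintegral (continuous_FTC2 (F := F) ax)//.
  - exact: continuous_subspaceT.
  - split; first by move=> t; rewrite in_itv/= => /dF [].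
    + exact: cvg_at_right_filter (@cF a).
    + exact: cvg_at_left_filter (@cF x).
  - by move=> t; rewrite in_itv/= derive1E => /dF [_ ->].
have := resolvent_intcc bg pGT GgE (ltW ax).
have bc := bounded_mfun_cst c.
rewrite (intccB a x bg b4G) => e2; rewrite (intccB a x bc b4G) in e1.
by rewrite (intccB a x bg bc); lra.
Qed.

(** The zero [a] recurs at [a + p]. *)
Lemma zero_free_arc_le (a b : R) : a < b -> G a = 0 ->
  (forall t, a < t < b -> G t != 0) -> b - a <= p.
Proof.
move: (p0) => p0' ab Ga Gn; rewrite leNgt; apply/negP => pab.
have : G (a + p) != 0 by apply: Gn; apply/andP; split; lra.
by rewrite pG Ga eqxx.
Qed.

(** An arc of length exactly [p] would have [F b = F a] by periodicity and [F b = - F a] by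
    [arc_end_speed], against [F a != 0]. Strictness yields the sign of the vorticity even when
    [p = pi / 2]. *)
Lemma zero_free_arc_lt (a b : R) : a < b -> G a = 0 -> G b = 0 ->
  (forall t, a < t < b -> G t != 0) -> b - a < p.
Proof.
move=> ab Ga Gb Gn; have abp := zero_free_arc_le ab Ga Gn.
rewrite lt_neqAle abp andbT; apply/eqP => e.
have abpi := le_trans abp ppi.
have := arc_speed_neq0 dG (@cF) dGF ab abpi Ga Gb Gn.
have := arc_end_speed dG (@cF) dGF ab abpi Ga Gb Gn.
have -> : b = a + p by lra.
by rewrite pF => e1 /eqP; apply; lra.
Qed.

(** Translates of [z] by multiples of [p] lie on both sides of [x], so there is a nearest zero on
    each side. *)
Lemma zero_free_arc (x : R) : G x != 0 -> (exists z, G z = 0) ->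
  exists a b, [/\ a < x, x < b, G a = 0, G b = 0 & forall t, a < t < b -> G t != 0].
Proof.
move=> Gx [z Gz].
have [n /andP[n1 n2]] := periodic_reduce (x - p) z p0.
have [k /andP[k1 k2]] := periodic_reduce x z p0.
have [|||a [a1 a2 a3 a4]] := @last_zero_le R G (z + p *~ n) x; [exact: cG|lra|by rewrite periodic_int|].
have [|||b [b1 b2 b3 b4]] := @first_zero_ge R G (z + p *~ k) x; [exact: cG|lra|by rewrite periodic_int|].
exists a, b; split=> //.
- by rewrite lt_neqAle a2 andbT; apply: contraNneq Gx => <-; rewrite a3.
- by rewrite lt_neqAle b1 andbT; apply: contraNneq Gx => ->; rewrite b3.
move=> t /andP[at_ tb]; case: (leP t x) => tx; first by apply: a4; rewrite at_.
by apply: b4; rewrite tb ltW.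
Qed.

(** The intervals []-n, n[] all have midpoint 0 and therefore share the constant [vort 0]. *)
Lemma nowhere_zero_constant : (forall x, G x != 0) ->
  exists c : R, {ae mu, forall x, g x = c}.
Proof.
move=> Gn; exists (vort 0); apply: ae_forall_itv => n.
have := @vorticity_ae (- n%:R) n%:R (fun t _ => Gn t).
by rewrite addNr mul0r.
Qed.

Lemma identically_zero_constant : (forall x, G x = 0) ->
  exists c : R, {ae mu, forall x, g x = c}.
Proof.
move=> G0; exists 0; apply: ae_forall_itv => n; apply: ae_eq0_itv => // x /andP[nx _].
have F0 y : F y = 0.
  have -> : G = cst 0 by apply/funext => z; rewrite G0.
  by rewrite derive1_cst.
have := resolvent_intcc bg pGT GgE nx; rewrite !F0 subrr => <-.
by apply: (congr1 (fun u => intcc u (- n%:R) x)); apply/funext => t; rewrite G0 mulr0 subr0.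
Qed.

Section Jumps.
Hypothesis zG : exists z, G z = 0.
Hypothesis nzG : exists x, G x != 0.

(** By [speed_at_zero], the common value of [|F|] at the zeros of [G]. *)
Let M := Num.sqrt (- 2 * C).

Let arcE (a b : R) : a < b -> G a = 0 -> G b = 0 -> (forall t, a < t < b -> G t != 0) ->
  [/\ F b = - F a, F a != 0, vort ((a + b) / 2) * F a < 0 &
      forall x, a <= x <= b -> `|F x| <= `|F a|].
Proof.
move=> ab Ga Gb Gn; have abp := zero_free_arc_lt ab Ga Gb Gn.
have abpi := le_trans (ltW abp) ppi.
split.
- exact: (arc_end_speed dG (@cF) dGF).
- exact: (arc_speed_neq0 dG (@cF) dGF ab).
- by apply: (arc_vorticity_sign dG (@cF) dGF) => //; exact: lt_le_trans abp ppi.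
- exact: (arc_speed_le dG (@cF) dGF).
Qed.

Lemma zero_speed_gt0 : 0 < M.
Proof.
have [x Gx] := nzG; have [a [b [ax xb Ga Gb Gn]]] := zero_free_arc Gx zG.
have [_ Fa _ _] := arcE (lt_trans ax xb) Ga Gb Gn.
by rewrite /M -(speed_at_zero dG (@cF) dGF Ga) sqrtr_sqr normr_gt0.
Qed.

Lemma zero_speed x : G x = 0 -> `|F x| = M.
Proof. by move=> Gx; rewrite /M -(speed_at_zero dG (@cF) dGF Gx) sqrtr_sqr. Qed.

Lemma zero_speedP x : G x = 0 -> (F x == M) || (F x == - M).
Proof. by move=> /zero_speed <-; case: ger0P => _; rewrite ?opprK eqxx ?orbT. Qed.

Lemma speed_bound x : - M <= F x <= M.
Proof.
rewrite -ler_norml; have [Gx|Gx] := eqVneq (G x) 0; first by rewrite zero_speed.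
have [a [b [ax xb Ga Gb Gn]]] := zero_free_arc Gx zG.
have [_ _ _ H] := arcE (lt_trans ax xb) Ga Gb Gn.
by rewrite -(zero_speed Ga); apply: H; rewrite !ltW.
Qed.

(** The two ends of a single zero-free arc have opposite speeds of modulus [M]. *)
Lemma speed_attains : (exists x, F x = M) /\ (exists x, F x = - M).
Proof.
have [x Gx] := nzG; have [a [b [ax xb Ga Gb Gn]]] := zero_free_arc Gx zG.
have [Fb _ _ _] := arcE (lt_trans ax xb) Ga Gb Gn.
case/orP: (zero_speedP Ga) => /eqP Fa; split.
- by exists a.
- by exists b; rewrite Fb Fa.
- by exists b; rewrite Fb Fa opprK.
- by exists a.
Qed.

(** Between two zeros of [G], [F] vanishes by Rolle, while [|F| = M] at the zeros themselves. With
    Lipschitz constant [K] this takes a distance of at least [M / K]. *)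
Lemma zeros_separated : exists2 d : R, 0 < d &
  forall x y, G x = 0 -> G y = 0 -> x < y -> d <= y - x.
Proof.
have [K K0 FK] := resolvent_derive_lipschitz bg pGT GgE.
exists (M / K); first exact: divr_gt0 zero_speed_gt0 K0.
move=> x y Gx Gy xy.
have [|||z] := @Rolle R G x y xy; [by move=> t _; case: (dG t)|exact: continuous_subspaceT|by rewrite Gx Gy|].
rewrite in_itv/= => /andP[xz zy] [_]; rewrite -derive1E => Fz.
rewrite ler_pdivrMr// -(zero_speed Gx) -[F x]opprK normrN -[- F x]add0r -Fz.
rewrite (le_trans (FK _ _))// mulrC ler_pM2r// ger0_norm ?subr_ge0 ?(ltW xz)//.
by rewrite lerB// ltW.
Qed.

Lemma zeros_enum : exists J : seq R, sorted <%R J /\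
  (forall x, x \in J <-> [/\ 0 <= x, x < T & G x = 0]).
Proof.
have [d d0 sep] := zeros_separated.
pose A := [set x : R | [/\ 0 <= x, x < T & G x = 0]].
have : finite_set A.
  apply: (@finite_separated R A 0 T d) => //.
    by move=> x [x0 xT _]; rewrite /= in_itv/= x0 ltW.
  by move=> x y [_ _ Gx] [_ _ Gy]; exact: sep.
move=> /finite_seqP[s As]; exists (sort <=%R (undup s)); split.
  by rewrite sort_lt_sorted undup_uniq.
move=> x; rewrite mem_sort mem_undup.
have -> : (x \in s) = (x \in A) by rewrite As; apply/idP/idP; rewrite inE.
by rewrite inE.
Qed.

(** [J] lists the zeros of [G] in one period. On each arc the vorticity has the sign opposite to [F]
    at the left end, and [F] changes sign from one zero to the next, so every zero is a genuine
    jump. *)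
Lemma jumps_structure :
  exists J : seq R, pw_const_jumps g J /\ at_opposite_extrema F J.
Proof.
have T0 : 0 < T by rewrite mulr_gt0// pi_gt0.
have [J [sJ JE]] := zeros_enum; exists J.
have GJ i : (i < size J)%N -> G (nth 0 J i) = 0.
  by move=> iJ; have /JE[] := mem_nth 0 iJ.
have J0 : (0 < size J)%N.
  have [z Gz] := zG; have [n /andP[n0 nT]] := periodic_reduce 0 z T0.
  have : z + T *~ n \in J by apply/JE; split=> //; [lra|rewrite periodic_int].
  by case: (J).
have Gend i : (i < size J)%N -> G (arc_end J i) = 0.
  by move=> iJ; rewrite /arc_end; case: ifP => [|_]; [exact: GJ|rewrite pGT; exact: GJ].
have ltJ i j : (i < size J)%N -> (j < size J)%N -> (nth 0 J i < nth 0 J j) = (i < j)%N.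
  by move=> iJ jJ; exact: lt_sorted_ltn_nth.
have J02 i : (i < size J)%N -> 0 <= nth 0 J i < T.
  by move=> iJ; have /JE[-> ->] := mem_nth 0 iJ.
have arclt i : (i < size J)%N -> nth 0 J i < arc_end J i.
  move=> iJ; rewrite /arc_end; case: ifP => [i1J|_]; first by rewrite ltJ.
  by have /andP[_ ?] := J02 _ iJ; have /andP[? _] := J02 _ J0; lra.
(* The last arc runs past [2 pi] to the first zero of the next period. A zero inside it would either
   lie below [2 pi] and beyond the last entry of [J], or, translated back, precede the first
   entry. *)
have arcn i t : (i < size J)%N -> nth 0 J i < t < arc_end J i -> G t != 0.
  move=> iJ /andP[it]; rewrite /arc_end; apply: contraTneq => Gt.
  have /andP[i0 _] := J02 _ iJ; rewrite -leNgt.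
  have tJ : t < T -> (index t J < size J)%N /\ nth 0 J (index t J) = t.
    move=> tT; have tin : t \in J by apply/JE; split=> //; lra.
    by rewrite index_mem nth_index.
  case: ifP => i1J.
    rewrite leNgt; apply/negP => ti.
    have [|jJ jt] := tJ; first by have /andP[_ ?] := J02 _ i1J; lra.
    move: it ti; rewrite -jt !ltJ// => ij; rewrite ltnS leqNgt => /negP; exact.
  case: (ltP t T) => tT.
    have [jJ jt] := tJ tT; move: it; rewrite -jt ltJ// => ij.
    by move: i1J; rewrite (leq_ltn_trans ij jJ).
  rewrite leNgt; apply/negP => ti.
  have /andP[j0 jT] := J02 _ J0.
  have : t - T \in J by apply/JE; split; [lra|lra|rewrite -pGT subrK].
  move=> tin; have : (index (t - T)%R J < size J)%N by rewrite index_mem.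
  move=> jJ; have := ltJ _ _ jJ J0; rewrite nth_index// ltn0 => /negbT; rewrite -leNgt; lra.
pose c i := vort ((nth 0 J i + arc_end J i) / 2).
have arcJ i : (i < size J)%N -> [/\ F (arc_end J i) = - F (nth 0 J i),
    F (nth 0 J i) != 0 & c i * F (nth 0 J i) < 0].
  move=> iJ; have [] := arcE (arclt i iJ) (GJ i iJ) (Gend i iJ) (fun t => @arcn i t iJ).
  by [].
split.
- split=> //; split=> //; split.
    by apply/allP => x /JE[-> ->].
  exists c => i iJ; split; first by apply: vorticity_ae => t; exact: arcn.
  (* The arc [j] ends at the [i]-th zero. For [i = 0] it is the last arc, and it ends at the
     translate by [2 pi] of the first zero, where [F] takes the same value. *)
  set j := ((i + size J).-1 %% size J)%N.
  have jJ : (j < size J)%N by rewrite ltn_pmod.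
  have Fj : F (arc_end J j) = F (nth 0 J i).
    rewrite /arc_end /j; case: i iJ @j jJ => [|i] iJ j jJ.
      rewrite add0n modn_small ?prednK// ?ltn_predL// ltnn.
      exact: pFT.
    rewrite addSn /= modnDr modn_small ?iJ//; exact: ltnW.
  have [_ _ ci] := arcJ _ iJ; have [Fj' _ cj] := arcJ _ jJ.
  apply/eqP => cij; move: ci cj; rewrite cij -Fj Fj' mulrN => ? ?; lra.
- exists M; split; first by rewrite gt_eqF// zero_speed_gt0.
  have [? ?] := speed_attains.
  split; first exact: speed_bound.
  do 2!split=> //.
  by apply/allP => x /JE[_ _ Gx]; exact: zero_speedP.
Qed.

End Jumps.

Lemma steady_structure :
  (exists c : R, {ae mu, forall x, g x = c}) \/
  (exists J : seq R, pw_const_jumps g J /\ at_opposite_extrema F J).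
Proof.
have [zG|/forallNP nzG] := pselect (exists z, G z = 0); last first.
  by left; apply: nowhere_zero_constant => x; apply/eqP.
have [nzG|/forallNP nG] := pselect (exists x, G x != 0).
  by right; exact: jumps_structure.
by left; apply: identically_zero_constant => x; apply/eqP/negPn/negP.
Qed.

End Structure.

(** * Reduction of essentially bounded solutions to bounded ones *)

Section EssentiallyBounded.
Context {R : realType}.
Local Notation mu := (@lebesgue_measure R).
Implicit Types (g h G : R -> R).

Lemma ae_and (P Q : R -> Prop) : {ae mu, forall x, P x} -> {ae mu, forall x, Q x} ->
  {ae mu, forall x, P x /\ Q x}.
Proof.
move=> aP aQ.
have : {ae mu, forall x (n : nat), if n is 0%N then P x else Q x}.
  by apply: ae_foralln => -[|n].
by apply: ae_imply => x H; split; [exact: (H 0%N)|exact: (H 1%N)].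
Qed.

(** Truncation at the levels [- |K|] and [|K|], which are in the right order for either sign of
    [K]. *)
Lemma ae_bounded_modification g (K : R) : measurable_fun [set: R] g ->
  {ae mu, forall x, `|g x| <= K} ->
  exists h, bounded_mfun h /\ {ae mu, forall x, g x = h x}.
Proof.
move=> mg gK; exists (fun x => Num.min `|K| (Num.max (- `|K|) (g x))); split.
  split; first by apply: measurable_minr => //; apply: measurable_maxr.
  exists `|K| => x; rewrite ler_norml le_min ge_min lexx/= le_max lexx andbT/=.
  by rewrite (le_trans _ (normr_ge0 K))// oppr_le0.
apply: ae_imply gK => x /le_trans/(_ (ler_norm K)); rewrite ler_norml => /andP[g1 g2].
by rewrite (max_idPr g1) (min_idPr g2).
Qed.

(** Both equations see [g] only through integrals, so here and in [steady_eq_ae] it may be changed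
    on a null set. *)
Lemma solves_resolvent_ae g h G : measurable_fun [set: R] g -> measurable_fun [set: R] h ->
  {ae mu, forall x, g x = h x} -> solves_resolvent g G -> solves_resolvent h G.
Proof.
move=> mg mh gh [dG gG]; split=> // x y xy; rewrite gG//.
have mG : measurable_fun [set: R] G.
  apply: continuous_measurable_fun => z.
  by apply/differentiable_continuous/derivable1_diffP; exact: dG.
have m4 (k : R -> R) : measurable_fun [set: R] k ->
    measurable_fun `[x, y] (fun t => (k t - 4 * G t)%:E).
  move=> mk0; apply/measurable_EFinP; apply: measurable_funTS.
  by apply: measurable_funB => //; exact: measurable_funM.
apply: ae_eq_integral => //; [exact: m4|exact: m4|].
by apply: ae_imply gh => t -> .
Qed.

Lemma steady_eq_ae g h G : measurable_fun [set: R] g -> measurable_fun [set: R] h ->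
  measurable_fun [set: R] G -> measurable_fun [set: R] (derive1 G) ->
  {ae mu, forall x, g x = h x} -> steady_eq g G -> steady_eq h G.
Proof.
move=> mg mh mG mF gh gG phi tphi; rewrite -[RHS](gG _ tphi).
have [[mphi _] [mphi' _] _] := test_fun_primitive tphi.
have mk (k : R -> R) : measurable_fun [set: R] k ->
    measurable_fun `[0, 2 * pi] (fun t => (G t * k t * derive1 phi t + derive1 G t * k t * phi t)%:E).
  move=> mk0; apply/measurable_EFinP; apply: measurable_funTS.
  by apply: measurable_funD => //; apply: measurable_funM => //; exact: measurable_funM.
apply: ae_eq_integral => //; [exact: mk|exact: mk|].
by apply: ae_imply gh => t ->.
Qed.

End EssentiallyBounded.

Theorem mainTheorem4 (R : realType) (m : nat) (g G : R -> R) :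
  (4 <= m)%N ->
  measurable_fun [set: R] g ->
  (exists M : R, {ae (@lebesgue_measure R), forall x, `|g x| <= M}) ->
  m_symmetric m g ->
  m_symmetric m G ->
  solves_resolvent g G ->
  steady_eq g G ->
  (exists c : R, {ae (@lebesgue_measure R), forall x, g x = c}) \/
  (exists J : seq R, pw_const_jumps g J /\ at_opposite_extrema (derive1 G) J).
Proof.
move=> m4 mg [K gK] _ pG gG sG.
have [h [bh gh]] := ae_bounded_modification mg gK.
have hG := solves_resolvent_ae mg bh.1 gh gG.
have m0 : 0 < m%:R :> R by rewrite ltr0n (leq_trans _ m4).
have p0 : 0 < 2 * pi / m%:R :> R by rewrite divr_gt0// mulr_gt0// pi_gt0.
(* Here [4 <= m] bounds the period by [pi / 2], the largest arc length for which the trigonometric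
   estimates are made. *)
have ppi : 2 * pi / m%:R <= pi / 2 :> R.
  have : 4%:R <= m%:R :> R by rewrite ler_nat.
  by rewrite ler_pdivrMr// => m4R; have := pi_gt0 R; nra.
have pGT : periodic G (2 * pi).
  move=> x; rewrite -[RHS](periodicn pG m); congr (G (x + _)).
  by rewrite -[RHS]mulr_natr divfK// gt_eqF.
have mG := (resolvent_bounded pGT hG).1.
have mF : measurable_fun [set: R] (derive1 G).
  by apply: continuous_measurable_fun; exact: resolvent_derive_continuous bh pGT hG.
have hs := steady_eq_ae mg bh.1 mG mF gh sG.
have [C dGF] := steady_first_integral bh pGT hG hs.
(* Both alternatives concern the vorticity only up to null sets, so they transfer from [h] back to
   [g]. *)
have [[c hc]|[J [[J0 [sJ [J2 [c hc]]]] Jx]]] := steady_structure bh p0 ppi pG pGT hG dGF.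
  by left; exists c; apply: ae_imply (ae_and gh hc) => x [-> ].
right; exists J; split=> //; split=> //; split=> //; split=> //.
exists c => i /hc[hi ci]; split=> //.
by apply: ae_imply (ae_and gh hi) => x [-> ].
Qed.
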